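(* For every integer $k\ge 3$, let $n=6k^2-5k$. Then there exists a finite simple edge-pancyclic graph of order $n$ with exactly $2n-k$ edges.
   Context: A $k$-cycle is a cycle of length $k$. A graph $G$ of order $n$ is edge-pancyclic if for every integer $m$ with $3\le m\le n$, every edge of $G$ lies in an $m$-cycle. *)

(* Defs.v *)
From mathcomp Require Import all_boot.
Set Implicit Arguments. Unset Strict Implicit. Unset Printing Implicit Defensive.

Definition simple_graph (T : finType) (e : rel T) : Prop :=
  symmetric e /\ irreflexive e.

Definition edge_set (T : finType) (e : rel T) : {set {set T}} :=
  [set E : {set T} | [exists x, exists y, e x y && (E == [set x; y])]].

Definition edge_in_cycle_of_length (T : finType) (e : rel T) (x y : T) (m : nat)
  : Prop :=
  exists s : seq T, [/\ size s = m, uniq s, cycle e s, x \in s &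
                        (next s x == y) || (next s y == x)].

Definition edge_pancyclic (T : finType) (e : rel T) : Prop :=
  forall x y : T, e x y ->
  forall m : nat, 3 <= m <= #|T| -> edge_in_cycle_of_length e x y m.

(* Main.v *)
(* Put g = 3(k-1) and N = 2g+1. A fragment is the triangulated strip made of
   two fans glued along the chord {g, g+1}: the hub g+1 sees the path 0, ..., g
   and the hub g sees the path g+1, ..., N. It has N+1 vertices and 4g+1 edges.
   Arrange k fragments in a ring, the vertex N of each being the vertex 0 of the
   next one; this gives kN = 6k^2-5k vertices and k(4g+1) = 2kN-k edges. A
   fragment can be traversed from 0 to N in any number of steps from 3 to N.
   Hence if some traversals through an edge have length d and N, then the edge
   lies in cycles around the ring of all lengths from d + 3(k-1) = d + g to kN.
   Shorter cycles are found inside the fragment: the longest one through the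
   chord {j, g+1} has 2g-j+2 vertices, while a traversal through this chord
   needs only g-j+3 steps, so the two ranges just meet. *)
Require Import Defs.
From mathcomp Require Import all_boot.
From mathcomp Require Import zify.
Set Implicit Arguments. Unset Strict Implicit. Unset Printing Implicit Defensive.

(** * Edges of a cycle as neighbouring list entries *)

(** Unlike [next], this survives concatenation, mapping and reversal of lists. The closing step of a
    cycle is not counted. *)
Definition consecutive (T : Type) (x y : T) (s : seq T) : Prop :=
  exists s1 s2, s = s1 ++ [:: x, y & s2] \/ s = s1 ++ [:: y, x & s2].

Lemma consecutiveC (T : Type) (x y : T) (s : seq T) :
  consecutive x y s -> consecutive y x s.
Proof. by move=> [s1 [s2 [->|->]]]; exists s1, s2; [right|left]. Qed.

Lemma consecutive_cat (T : Type) (x y : T) (s t : seq T) :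
  consecutive x y s -> consecutive x y (s ++ t).
Proof.
by move=> [s1 [s2 [->|->]]]; exists s1, (s2 ++ t); [left|right]; rewrite -catA.
Qed.

Lemma consecutive_map (T U : Type) (h : T -> U) (x y : T) (s : seq T) :
  consecutive x y s -> consecutive (h x) (h y) (map h s).
Proof.
by move=> [s1 [s2 [->|->]]]; exists (map h s1), (map h s2); [left|right];
  rewrite map_cat.
Qed.

Lemma consecutive_rev (T : Type) (x y : T) (s : seq T) :
  consecutive x y s -> consecutive x y (rev s).
Proof.
by move=> [s1 [s2 [->|->]]]; exists (rev s2), (rev s1); [right|left];
  rewrite rev_cat !rev_cons -!cats1 -!catA.
Qed.

Lemma edge_in_cycleC (T : finType) (e : rel T) (x y : T) (m : nat) :
  edge_in_cycle_of_length e x y m -> edge_in_cycle_of_length e y x m.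
Proof.
move=> [s [sz us cs xs xy]]; exists s; split => //; last by rewrite orbC.
by case/orP: xy => /eqP E; [rewrite -E mem_next | rewrite -E mem_next in xs].
Qed.

Lemma consecutive_in_cycle (T : finType) (e : rel T) (x y : T) (s : seq T) :
  uniq s -> cycle e s -> consecutive x y s ->
  edge_in_cycle_of_length e x y (size s).
Proof.
have main u v s1 s2 : let s' := s1 ++ [:: u, v & s2] in
    uniq s' -> cycle e s' -> edge_in_cycle_of_length e u v (size s').
  move=> s' us cs; exists s'; split => //; first by rewrite mem_cat !inE eqxx orbT.
  by rewrite -(next_rot (size s1) us) rot_size_cat /= eqxx eqxx.
move=> us cs [s1 [s2 [E|E]]]; rewrite E in us cs *; first exact: main.
exact/edge_in_cycleC/main.
Qed.

Lemma last_iota x c : last x (iota x.+1 c) = x + c.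
Proof. by elim: c x => [|c IH] x /=; rewrite ?IH; lia. Qed.

(** * Cycles and traversals of a single fragment *)

Section Fragment.
Variable g : nat.
Let N := (2 * g).+1.

Definition frag_arc (p q : nat) : bool :=
  [&& p < q, q <= N & [|| q == p.+1, q == g.+1 | p == g]].

Definition frag (p q : nat) : bool := frag_arc p q || frag_arc q p.

Lemma frag_sym : symmetric frag.
Proof. by move=> p q; rewrite /frag orbC. Qed.

(** The reflection exchanges the hubs [g] and [g.+1], hence the two fans. *)
Lemma frag_mirror p q : frag p q -> frag (N - p) (N - q).
Proof. rewrite /frag /frag_arc /N; lia. Qed.

Lemma path_iota x c : x + c <= N -> path frag x (iota x.+1 c).
Proof.
elim: c x => [|c IH] x //= H; rewrite IH ?andbT; last by lia.
by rewrite /frag /frag_arc; lia.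
Qed.

Lemma path_rev_iota x a c : a + c <= N -> frag x (a + c) ->
  path frag x (rev (iota a c.+1)).
Proof.
elim: c x => [|c IH] x H xc; first by rewrite /= -{1}(addn0 a) xc.
rewrite -addn1 iotaD rev_cat /= xc /=; apply: IH; first by lia.
by rewrite /frag /frag_arc; lia.
Qed.

Lemma path_after_g c : c <= g -> path frag g (iota g.+2 c).
Proof.
case: c => // c cg; rewrite /= path_iota ?andbT /N; last by lia.
by rewrite /frag /frag_arc; lia.
Qed.

Definition frag_cycle (p q m : nat) : Prop :=
  exists s, [/\ size s = m, uniq s, all (geq N) s, cycle frag s
              & consecutive p q s].

Definition through (p q l : nat) : Prop :=
  exists s, let t := 0 :: rcons s N in
    [/\ size t = l.+1, uniq t, all (geq N) t, path frag 0 (rcons s N)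
      & consecutive p q t].

(** From length [d + g] on, a traversal with [d] steps leaves at least [g] steps for the rest of the
    ring, enough for three per fragment. Shorter cycles must stay inside the fragment. *)
Definition good (p q : nat) : Prop :=
  exists d, [/\ forall m, 3 <= m < d + g -> frag_cycle p q m,
               d <= N, through p q d & through p q N].

Lemma cycle_mirror p q m : p <= N -> q <= N ->
  frag_cycle p q m -> frag_cycle (N - p) (N - q) m.
Proof.
move=> pN qN [s [sz us /allP sN cs pq]]; exists (map (subn N) s); split.
- by rewrite size_map.
- rewrite map_inj_in_uniq // => x y /sN /= xN /sN /= yN; lia.
- by apply/allP => _ /mapP [x _ ->] /=; lia.
- case: s cs {sz us sN pq} => // x s; rewrite /= -map_rcons => cs.
  by apply: homo_path cs => a b; apply: frag_mirror.
- exact: consecutive_map.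
Qed.

(** Reflection exchanges the ends [0] and [N], so the reflected list is read backwards. *)
Lemma through_mirror p q l : through p q l -> through (N - p) (N - q) l.
Proof.
move=> [s [sz us /allP sN ps pq]].
have E : rev (map (subn N) (0 :: rcons s N)) = 0 :: rcons (rev (map (subn N) s)) N.
  by rewrite /= map_rcons rev_cons rev_rcons subn0 subnn.
exists (rev (map (subn N) s)); rewrite -E; split.
- by rewrite size_rev size_map.
- by rewrite rev_uniq map_inj_in_uniq // => x y /sN /= xN /sN /= yN; lia.
- by apply/allP => x; rewrite mem_rev => /mapP [y _ ->] /=; lia.
- have : sorted frag (rev (map (subn N) (0 :: rcons s N))); last by rewrite E.
  rewrite rev_sorted (eq_sorted (e' := frag)); last by move=> x y; apply: frag_sym.
  by rewrite sorted_map; apply: sub_path ps => x y; apply: frag_mirror.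
- exact/consecutive_rev/consecutive_map.
Qed.

Lemma good_mirror p q : p <= N -> q <= N -> good p q -> good (N - p) (N - q).
Proof.
move=> pN qN [d [cyc dN thd thN]]; exists d; split=> //; try exact: through_mirror.
by move=> m /cyc; apply: cycle_mirror.
Qed.

(** A short cycle stays in the fan of [g.+1]: hub, then a stretch of the path from [j]. A longer one
    runs from [j] to [g], jumps into the other fan and descends to the hub. Starting with
    [g.+1, j, j.+1], it serves both the chord and the path edge at [j]. *)
Lemma cycle_fan j m : j <= g -> 3 <= m <= 2 * g - j + 2 ->
  exists s, [/\ size s = m, uniq s, all (geq N) s, cycle frag s
    & exists s', s = [:: g.+1, j & if j < g then j.+1 :: s' else s']].
Proof.
move=> jg mB; have [mj|mj] := leqP m (g - j + 2).
  exists (g.+1 :: iota j m.-1); split.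
  - by rewrite /= size_iota; lia.
  - by rewrite /= iota_uniq mem_iota andbT; lia.
  - by apply/allP => x /=; rewrite inE mem_iota /N; lia.
  - have -> : m.-1 = m.-2.+1 by lia.
    rewrite /= rcons_path path_iota /N; last by lia.
    by rewrite last_iota /frag /frag_arc; lia.
  - exists (iota j.+2 (m - 3)); have -> : j < g by lia.
    by case: m mB mj => [|[|[|m]]] //; rewrite !subSS subn0.
pose c := m - (g - j + 2).
exists (g.+1 :: iota j (g - j).+1 ++ rev (iota g.+2 c)); split.
- by rewrite /= size_cat size_rev !size_iota /c; lia.
- rewrite cons_uniq cat_uniq rev_uniq !iota_uniq mem_cat mem_rev !mem_iota andbT.
  apply/andP; split; first by lia.
  apply/hasPn => x; rewrite mem_rev !mem_iota; lia.
- apply/allP => x; rewrite inE mem_cat mem_rev !mem_iota /= /N /c; lia.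
- rewrite [cycle _ _]/= rcons_cat cat_path path_iota /N; last by lia.
  rewrite last_iota subnKC // -rev_cons -/(iota g.+1 c.+1) path_rev_iota ?andbT //.
  + by rewrite /frag /frag_arc; lia.
  + by rewrite /N /c; lia.
  + by rewrite /frag /frag_arc /c; lia.
- case: ltnP => H.
    by exists (iota j.+2 (g - j).-1 ++ rev (iota g.+2 c)); case: (g - j) (subn_gt0 j g) => //; rewrite H.
  by exists (iota j.+1 (g - j) ++ rev (iota g.+2 c)).
Qed.

Lemma through_intro p q t :
  uniq (0 :: t) -> all (geq N) (0 :: t) -> path frag 0 t -> last 0 t = N ->
  consecutive p q (0 :: t) -> through p q (size t).
Proof.
case/lastP: t => [|t x]; first by rewrite /N.
rewrite last_rcons => ut tN pt xN pq; subst x.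
by exists t; split; rewrite /= ?size_rcons.
Qed.

(** The jump to the hub [g.+1] and back to [j] skips the path before [j]; the hub [g] is adjacent to
    [N]. *)
Lemma through_short p q j : 0 < j <= g ->
  consecutive p q [:: 0, g.+1, j & rcons (iota j.+1 (g - j)) N] ->
  through p q (g - j + 3).
Proof.
move=> jg pq.
pose t := [:: g.+1, j & rcons (iota j.+1 (g - j)) N].
have -> : g - j + 3 = size t by rewrite /= size_rcons size_iota; lia.
apply: through_intro => //.
- by rewrite /= !inE !mem_rcons !inE rcons_uniq !mem_iota iota_uniq /N; lia.
- by apply/allP => x; rewrite !(inE, mem_rcons) mem_iota /= /N; lia.
- rewrite /= rcons_path path_iota ?last_iota /N; last by lia.
  by rewrite /frag /frag_arc; lia.
- by rewrite /= last_rcons.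
Qed.

(** A Hamiltonian traversal: the hub [g.+1] is inserted between [j - 1] and [j], and the hub [g]
    steps over it to [g.+2]. *)
Lemma through_long p q j : 0 < j <= g ->
  consecutive p q
    (iota 0 j ++ [:: g.+1] ++ iota j (g - j).+1 ++ iota g.+2 g) ->
  through p q N.
Proof.
move=> jg; set t := _ ++ _ => pq.
have pt : perm_eq t (iota 0 N.+1).
  rewrite /t perm_catCA [X in perm_eq (_ ++ X)]catA -iotaD.
  have -> : j + (g - j).+1 = g.+1 by lia.
  rewrite perm_catCA -[_ ++ iota g.+2 g]/(iota g.+1 g.+1) -iotaD.
  by have -> : g.+1 + g.+1 = N.+1 by rewrite /N; lia.
have [t' Et] : exists t', t = 0 :: t'.
  by rewrite /t; case: (j) jg => // j' _; rewrite /=; eexists.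
have -> : N = size t' by have := perm_size pt; rewrite Et /= size_iota => -[].
apply: through_intro; rewrite -?Et //.
- by rewrite (perm_uniq pt) iota_uniq.
- by rewrite (perm_all _ pt); apply/allP => x; rewrite mem_iota /=; lia.
- have : sorted frag t; last by rewrite Et.
  rewrite /t; case: (j) jg => // j' jg' /=.
  rewrite cat_path /= cat_path !path_iota ?last_iota /N; try by lia.
  rewrite subnKC // path_after_g // /frag /frag_arc; lia.
- have : last 0 t = N; last by rewrite Et.
  by rewrite /t !last_cat -nth_last size_iota nth_iota /N; lia.
Qed.

Lemma hub_good j : 0 < g -> j <= g -> good j g.+1.
Proof.
move=> g0 jg.
have [j0|j0] := posnP j.
  (* Every short traversal begins with the chord {0, g+1}, so the shortest one, 0, g+1, g, N, is
     available. *)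
  exists 3; split; rewrite /N ?j0; try lia.
  - move=> m mB; have [||s [sz us sN cs [s' Es]]] := @cycle_fan 0 m; try lia.
    exists s; split => //; exists [::]; eexists; right; rewrite Es; reflexivity.
  - have -> : 3 = g - g + 3 by rewrite subnn.
    apply: (@through_short _ _ g); first by lia.
    by exists [::]; eexists; left; reflexivity.
  - apply: (@through_long _ _ 1); first by lia.
    by exists [::]; eexists; left; reflexivity.
exists (g - j + 3); split; rewrite /N; try lia.
- move=> m mB; have [||s [sz us sN cs [s' Es]]] := @cycle_fan j m; try lia.
  by exists s; split => //; exists [::]; eexists; right; rewrite Es; reflexivity.
- apply: (@through_short _ _ j); first by lia.
  by exists [:: 0]; eexists; right; reflexivity.
- apply: (@through_long _ _ j); first by lia.
  by exists (iota 0 j); eexists; right; reflexivity.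
Qed.

Lemma path_edge_good j : 1 < g -> j < g -> good j j.+1.
Proof.
move=> g1 jg.
have cyc m : 3 <= m <= 2 * g - j + 2 -> frag_cycle j j.+1 m.
  move=> mB; have [||s [sz us sN cs [s' Es]]] := @cycle_fan j m; try lia.
  rewrite jg in Es.
  by exists s; split => //; exists [:: g.+1]; eexists; left; rewrite Es; reflexivity.
have [j0|j0] := posnP j.
  (* No short traversal uses {0, 1}; take 0, 1, g+1, g, N, and the whole path for length [N]. *)
  exists 4; split; rewrite /N ?j0; try lia.
  - by move=> m mB; rewrite -{1}j0 -j0; apply: cyc; lia.
  - apply: (@through_intro _ _ [:: 1; g.+1; g; N]) => //.
    + by rewrite /= !inE /N; lia.
    + by apply/allP => x; rewrite !inE /= /N; lia.
    + by rewrite /= /frag /frag_arc /N; lia.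
    + by exists [::]; eexists; left; reflexivity.
  - rewrite -/N -[N](size_iota 1 N); apply: through_intro.
    + by rewrite -[0 :: _]/(iota 0 N.+1) iota_uniq.
    + by apply/allP => x; rewrite -[0 :: _]/(iota 0 N.+1) mem_iota /=; lia.
    + by rewrite path_iota.
    + by rewrite last_iota.
    + by exists [::]; eexists; left; reflexivity.
have Ej : g - j = (g - j.+1).+1 by lia.
exists (g - j + 3); split; rewrite /N; try lia.
- by move=> m mB; apply: cyc; lia.
- apply: (@through_short _ _ j); first by lia.
  rewrite Ej; by exists [:: 0; g.+1]; eexists; left; reflexivity.
- apply: (@through_long _ _ j); first by lia.
  by exists (iota 0 j ++ [:: g.+1]); eexists; left; rewrite Ej -catA; reflexivity.
Qed.

Lemma goodC p q : good p q -> good q p.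
Proof.
move=> [d [cyc dN [s [s1 s2 s3 s4 s5]] [t [t1 t2 t3 t4 t5]]]].
exists d; split => //; [|exists s | exists t]; try by split => //; apply: consecutiveC.
by move=> m /cyc [u [u1 u2 u3 u4 u5]]; exists u; split => //; apply: consecutiveC.
Qed.

Lemma frag_good p q : 1 < g -> frag p q -> good p q.
Proof.
move=> g1; wlog: p q / frag_arc p q.
  by move=> W /orP [H|H]; [apply: W | apply: goodC; apply: W]; rewrite // /frag H.
move=> /and3P [pq qN /or3P E] _; rewrite /N in qN.
(* Path edges beyond the hubs and chords at [g] are mirror images of edges already treated. *)
have mir a b : good (N - b) (N - a) -> a < b <= N -> good a b.
  move=> H ab; apply: goodC; have := good_mirror _ _ H.
  by rewrite !subKn; [apply; lia | lia | lia].
case: E => /eqP E; rewrite ?E in pq qN *.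
- have [pg|gp|->] := ltngtP p g; first exact: path_edge_good.
    apply: mir; last by rewrite /N; lia.
    have -> : N - p = (N - p.+1).+1 by rewrite /N; lia.
    by apply: path_edge_good => //; rewrite /N; lia.
  by apply: hub_good; lia.
- by apply: hub_good; lia.
- apply: mir; last by rewrite /N; lia.
  have -> : N - g = g.+1 by rewrite /N; lia.
  by apply: hub_good; rewrite /N; lia.
Qed.

End Fragment.

(** * Edges with the same ends on the ring *)

Section ArcEnds.
(* [v] and [u] are the residues of [a + h] and [b + h'], which lie in [0, n]. *)
Variables N n a b l h l' h' u v : nat.
Hypotheses (n_ge : 3 * N <= n) (an : a + N <= n) (bn : b + N <= n).
Hypotheses (lh : l < h <= N) (lh' : l' < h' <= N).
Hypotheses (vE : v = a + h \/ a + h = n /\ v = 0).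
Hypotheses (uE : u = b + h' \/ b + h' = n /\ u = 0).
Hypotheses (hi : v = b + l' \/ v = u) (lo : a + l = b + l' \/ a + l = u).

(** Two different fragments meet only where one ends and the other begins; among at least three
    fragments this gives at most one common vertex, so no common edge. *)
Lemma arcs_distinct : ~ (a + N <= b \/ b + N <= a).
Proof. by move=> [] sep; case: vE => [?|[? ?]]; case: uE => [?|[? ?]]; lia. Qed.

(** Wrapping can only send the end of the last fragment to [0], which is not among its other
    positions; the orientation excludes exchanged ends. *)
Lemma arcs_eq : a = b -> l = l' /\ h = h'.
Proof. by move=> ab; case: vE => [?|[? ?]]; case: uE => [?|[? ?]]; lia. Qed.
End ArcEnds.

(** * The ring of fragments and cycles around it *)

Section Ring.
Variables k g : nat.
Let N := (2 * g).+1.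
Let n := k * N.

(* Position [x] on the ring is read modulo [k * N], so that the offset [N] in
   fragment [i] is the offset [0] in fragment [i + 1], cyclically. *)
Definition ring_graph : rel 'I_(k * (2 * g).+1) := fun x y =>
  [exists i : 'I_k, exists p : 'I_N.+1, exists q : 'I_N.+1,
    [&& frag g p q, val x == (i * N + p) %% n & val y == (i * N + q) %% n]].

Lemma frag_bound p q : frag g p q -> (p <= N) * (q <= N) * (p != q).
Proof. by rewrite /frag /frag_arc /N => H; do !split; lia. Qed.

Lemma ring_graphP x y :
  reflect (exists i p q, [/\ i < k, frag g p q, val x = (i * N + p) %% n
                           & val y = (i * N + q) %% n])
          (ring_graph x y).
Proof.
apply: (iffP existsP) => [[i /existsP [p /existsP [q /and3P [pq /eqP ? /eqP ?]]]]|].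
  by exists i, p, q.
move=> [i [p [q [ik pq xE yE]]]]; have [[pN qN] _] := frag_bound pq.
exists (Ordinal ik); apply/existsP; exists (inord p); apply/existsP; exists (inord q).
by rewrite /= !inordK // pq xE yE !eqxx.
Qed.

Lemma ring_graph_sym : symmetric ring_graph.
Proof.
by move=> x y; apply/ring_graphP/ring_graphP => -[i [p [q [? ? ? ?]]]];
  exists i, q, p; rewrite frag_sym.
Qed.

Hypothesis k_gt2 : 2 < k.

Let n_gt0 : 0 < n. Proof. by rewrite muln_gt0; lia. Qed.

Definition vertex (x : nat) : 'I_(k * (2 * g).+1) := Ordinal (ltn_pmod x n_gt0).

Lemma vertex_inj_window a x y : a <= x < a + n -> a <= y < a + n ->
  vertex x = vertex y -> x = y.
Proof.
move=> xa ya /(congr1 val) /= E; wlog xy : x y xa ya E / x <= y.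
  by move=> W; case/orP: (leq_total x y) => H; [|symmetry]; apply: W.
have : n %| y - x by rewrite -eqn_mod_dvd // E.
have [//|d0] := posnP (y - x); first by lia.
by move/(dvdn_leq d0); lia.
Qed.

Lemma vertex_uniq a s : uniq s -> all (fun x => a <= x < a + n) s ->
  uniq (map vertex s).
Proof.
move=> us /allP sa; rewrite map_inj_in_uniq // => x y /sa xa /sa ya.
exact: vertex_inj_window xa ya.
Qed.

(** [j] may exceed [k], so that a tour starting in any fragment has positions in one window of
    length [n]. *)
Lemma ring_edge j p q : frag g p q ->
  ring_graph (vertex (j * N + p)) (vertex (j * N + q)).
Proof.
move=> pq; apply/ring_graphP; exists (j %% k), p, q; split=> //=.
- by rewrite ltn_pmod; lia.
- by rewrite {1}(divn_eq j k) mulnDl -mulnA -addnA modnMDl.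
- by rewrite {1}(divn_eq j k) mulnDl -mulnA -addnA modnMDl.
Qed.

Lemma ring_path j p s : path (frag g) p s ->
  path ring_graph (vertex (j * N + p)) (map vertex (map (addn (j * N)) s)).
Proof.
by elim: s p => //= q s IH p /andP [pq /IH ->]; rewrite ring_edge.
Qed.

Lemma ring_graph_irr : irreflexive ring_graph.
Proof.
move=> x; apply/negbTE/negP => xx.
have [i [p [q [ik pq xE yE]]]] := ring_graphP x x xx.
have [[pN qN] {}pq] := frag_bound pq.
suff : i * N + p = i * N + q by lia.
apply: (@vertex_inj_window (i * N)); last first.
  by apply: val_inj; rewrite /= -xE -yE.
- by rewrite /n; nia.
- by rewrite /n; nia.
Qed.

Definition segment (j m l : nat) : Prop :=
  exists s, [/\ size s = l.-1, uniq s,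
    all (fun x => j * N < x < (j + m) * N) s
  & path ring_graph (vertex (j * N)) (map vertex (rcons s ((j + m) * N)))].

Lemma segment_through j p q l : through g p q l -> segment j 1 l.
Proof.
move=> [s [/= sz /andP [s0 us] /allP sN ps _]].
move: us; rewrite rcons_uniq => /andP [sN' us].
exists (map (addn (j * N)) s); split.
- by rewrite size_map; move: sz; rewrite size_rcons => -[<-].
- by rewrite map_inj_uniq // => x y /addnI.
- apply/allP => _ /mapP [x xs ->].
  have xN : x <= N by apply: sN; rewrite mem_rcons inE xs orbT.
  have x0 : x != 0 by apply: contraNneq s0 => <-; rewrite mem_rcons inE xs orbT.
  have xN' : x != N by apply/eqP => xE; case/negP: sN'; move: xs; rewrite xE.
  by rewrite mulnDl mul1n; lia.
- have := ring_path j ps; rewrite addn0 map_rcons.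
  by rewrite mulnDl mul1n.
Qed.

Lemma segment_cat j m1 m2 l1 l2 : 0 < m1 -> 0 < m2 -> 0 < l1 -> 0 < l2 ->
  segment j m1 l1 -> segment (j + m1) m2 l2 -> segment j (m1 + m2) (l1 + l2).
Proof.
move=> m1p m2p l1p l2p [s [sz us /allP sN ps]] [t [tz ut /allP tN pt]].
exists (s ++ (j + m1) * N :: t); split.
- by rewrite size_cat /= sz tz; lia.
- rewrite cat_uniq /= us ut andbT /= negb_or -!andbA; apply/and3P; split.
  + by apply/negP => /sN; lia.
  + by apply/hasPn => x /tN xt; apply/negP => /sN; lia.
  + by apply/negP => /tN; lia.
- rewrite all_cat /=; apply/and3P; split.
  + by apply/allP => x /sN; rewrite !mulnDl; lia.
  + by rewrite !ltn_mul2r /N; lia.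
  + by apply/allP => x /tN; rewrite !mulnDl; lia.
- rewrite rcons_cat rcons_cons addnA -cat_rcons map_cat cat_path ps.
  by rewrite map_rcons last_rcons.
Qed.

(** Up to [g + 2] steps a short traversal with [j = g + 3 - l] works. Beyond that, follow the path
    to [g] and let this hub jump over [N - l] vertices. *)
Lemma through_any l : 0 < g -> 3 <= l <= N -> exists p q, through g p q l.
Proof.
move=> g0 lB; have [lg|lg] := leqP l (g + 2).
  exists 0, g.+1; have -> : l = g - (g + 3 - l) + 3 by lia.
  by apply: through_short; [lia | exists [::]; eexists; left; reflexivity].
exists 0, 1; pose a := N - l.
have -> : l = size (iota 1 g ++ iota (g.+1 + a) (g.+1 - a)).
  by rewrite size_cat !size_iota /a; lia.
apply: through_intro.
- rewrite -cat_cons -[0 :: _]/(iota 0 g.+1) cat_uniq !iota_uniq andbT.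
  by apply/hasPn => x; rewrite !mem_iota; lia.
- by apply/allP => x; rewrite inE mem_cat !mem_iota /a /=; lia.
- rewrite cat_path path_iota ?last_iota; last by lia.
  have -> : g.+1 - a = (g - a).+1 by rewrite /a; move: lB; rewrite /N; lia.
  by rewrite /= path_iota ?andbT /frag /frag_arc /a; lia.
- by rewrite last_cat -nth_last size_iota nth_iota /a; move: lB; rewrite /N; lia.
- by case: (g) g0 => // g' _; exists [::]; eexists; left; reflexivity.
Qed.

Lemma segment_any j m l : 0 < g -> 0 < m -> 3 * m <= l <= m * N -> segment j m l.
Proof.
move=> g0; elim: m j l => // -[|m] IH j l _ lB.
  have [||p [q pq]] := @through_any l; try lia.
  exact: segment_through pq.
(* The first fragment takes as many steps as it can while leaving three for each of the others. *)
pose l1 := minn N (l - 3 * m.+1).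
have l1B : 3 <= l1 <= N by rewrite /l1 /N; lia.
have l2B : 3 * m.+1 <= l - l1 <= m.+1 * N.
  have : 3 * m.+1 <= m.+1 * N by rewrite mulnC leq_mul2l /N; lia.
  by move: lB; rewrite [m.+2 * N]mulSn /l1; lia.
have -> : l = l1 + (l - l1) by rewrite /l1; lia.
rewrite -(add1n m.+1); apply: segment_cat; try lia.
  have [p [q pq]] := through_any g0 l1B; exact: segment_through pq.
exact: IH.
Qed.

Lemma ring_cycle_around j p q d l : 0 < g -> through g p q d ->
  3 * k.-1 <= l <= k.-1 * N ->
  edge_in_cycle_of_length ring_graph (vertex (j * N + p)) (vertex (j * N + q)) (d + l).
Proof.
move=> g0 [s [sz us /allP sN ps pq]] lB.
have [|t [tz ut /allP tN pt]] := @segment_any j.+1 k.-1 l g0 _ lB; first by lia.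
pose u := map (addn (j * N)) (0 :: rcons s N) ++ t.
(* The other [k.-1] fragments lead back to the starting vertex, which is therefore not listed again
   in [u]. *)
have jk : (j.+1 + k.-1) * N = n + j * N.
  by rewrite /n -mulnDl; congr (_ * _); lia.
have uE : d + l = size (map vertex u).
  by rewrite !(size_map, size_cat) sz tz; lia.
rewrite uE; apply: consecutive_in_cycle.
- apply: (@vertex_uniq (j * N)).
    rewrite cat_uniq ut andbT map_inj_uniq ?us; last by move=> x y /addnI.
    apply/hasPn => x /tN xt; apply/negP => /mapP [y /sN /= yN xE].
    by move: xt; rewrite xE mulSn; lia.
  rewrite all_cat; apply/andP; split; apply/allP.
    by move=> _ /mapP [x /sN /= xN ->]; rewrite /n; nia.
  by move=> x /tN; rewrite jk mulSn; lia.
- have E : vertex ((j.+1 + k.-1) * N) = vertex (j * N + 0).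
    by apply: val_inj; rewrite /= jk addn0 modnDl.
  rewrite /u map_cat /= rcons_cat cat_path ring_path //=.
  rewrite map_rcons E in pt; move: pt; congr (path _ _ _).
  by rewrite !map_rcons last_rcons; congr vertex; lia.
- rewrite /u map_cat; apply: consecutive_cat; rewrite -map_comp.
  exact: (consecutive_map (fun p => vertex (j * N + p))).
Qed.

Lemma ring_cycle_inside j p q m : frag_cycle g p q m ->
  edge_in_cycle_of_length ring_graph (vertex (j * N + p)) (vertex (j * N + q)) m.
Proof.
move=> [s [<- us /allP sN cs pq]].
rewrite -(size_map (addn (j * N)) s) -(size_map vertex).
apply: consecutive_in_cycle.
- apply: (@vertex_uniq (j * N)).
    by rewrite map_inj_uniq // => x y /addnI.
  by apply/allP => _ /mapP [x /sN /= xN ->]; rewrite /n; nia.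
- case: s cs {us sN pq} => //= x s /(ring_path j).
  by rewrite !map_rcons.
- by rewrite -map_comp; exact: (consecutive_map (fun p => vertex (j * N + p))).
Qed.

(** * Counting the edges *)

(* Arcs are numbered with the [N] arcs [(r, r + 1)] first, then the arcs
   [(r - N, g + 1)] with [r - N < g], then the arcs [(g, r - N + 2)]. *)
Definition arc_lo (r : nat) : nat := if r < N then r else minn (r - N) g.
Definition arc_hi (r : nat) : nat := if r < N then r.+1 else maxn g.+1 (r - N + 2).

(** The edge {g, g+1} is counted on the path, so each fan adds [g] chords to the [N] path arcs. *)
Lemma frag_arcP p q :
  reflect (exists2 r, r < 4 * g + 1 & p = arc_lo r /\ q = arc_hi r) (frag_arc g p q).
Proof.
rewrite /frag_arc /arc_lo /arc_hi; apply: (iffP idP) => [H|[r rB [-> ->]]].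
  have [qp|qp] := eqVneq q p.+1; first by exists p; rewrite /N; case: ltnP; lia.
  have [qg|qg] := eqVneq q g.+1; first by exists (N + p); rewrite /N; case: ltnP; lia.
  by exists (N + q - 2); rewrite /N; case: ltnP; lia.
by case: (ltnP r N); rewrite /N; lia.
Qed.

Lemma arc_inj r s : arc_lo r = arc_lo s -> arc_hi r = arc_hi s -> r = s.
Proof. by rewrite /arc_lo /arc_hi; case: (ltnP r N); case: (ltnP s N); lia. Qed.

Definition arc_edge (ir : 'I_k * 'I_(4 * g + 1)) : {set 'I_(k * (2 * g).+1)} :=
  [set vertex (ir.1 * N + arc_lo ir.2); vertex (ir.1 * N + arc_hi ir.2)].

Lemma arc_edge_inj : injective arc_edge.
Proof.
have arcB (t : 'I_(4 * g + 1)) : arc_lo t < arc_hi t <= N.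
  have : frag_arc g (arc_lo t) (arc_hi t) by apply/frag_arcP; exists (val t) => //; apply: ltn_ord.
  by case/and3P => -> ->.
have sB (l : 'I_k) : l * N + N <= n by rewrite -mulSnr leq_mul2r ltn_ord orbT.
have n3 : 3 * N <= n by rewrite leq_mul2r k_gt2 orbT.
(* Only the upper end of an arc can reach [n] and wrap to [0]. *)
have hi_mod x : x <= n -> x %% n = x \/ x = n /\ x %% n = 0.
  by case: ltngtP => // [H|->] _; [left; rewrite modn_small | right; rewrite modnn].
move=> [i r] [j s] E.
have : vertex (i * N + arc_lo r) \in arc_edge (j, s) by rewrite -E !inE eqxx.
have : vertex (i * N + arc_hi r) \in arc_edge (j, s) by rewrite -E !inE eqxx orbT.
rewrite !inE -!val_eqE /= {E} => /pred2P hi /pred2P lo.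
move: (arcB r) (arcB s) (sB i) (sB j) => rB sB' iB jB.
have il : (i * N + arc_lo r) %% n = i * N + arc_lo r by rewrite modn_small; lia.
have jl : (j * N + arc_lo s) %% n = j * N + arc_lo s by rewrite modn_small; lia.
rewrite il jl {il jl} in hi lo.
have ih : i * N + arc_hi r <= n by lia.
have jh : j * N + arc_hi s <= n by lia.
move: (hi_mod _ ih) (hi_mod _ jh) => {ih jh hi_mod} ih jh.
have Nn : 0 < N by [].
have [ij|ij|/val_inj ij] := ltngtP i j.
- have sep : i * N + N <= j * N by rewrite -mulSnr leq_mul2r ij orbT.
  by case: (arcs_distinct n3 iB jB rB sB' ih jh hi lo); left.
- have sep : j * N + N <= i * N by rewrite -mulSnr leq_mul2r ij orbT.
  by case: (arcs_distinct n3 iB jB rB sB' ih jh hi lo); right.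
subst j; have [lo_eq hi_eq] := arcs_eq n3 iB jB rB sB' ih jh hi lo erefl.
by congr pair; apply/val_inj/arc_inj.
Qed.

Lemma card_ring_edges : #|edge_set ring_graph| = k * (4 * g + 1).
Proof.
suff -> : edge_set ring_graph = [set arc_edge ir | ir in setT].
  by rewrite (card_imset _ arc_edge_inj) cardsT card_prod !card_ord.
apply/setP => A; rewrite inE; apply/idP/imsetP.
  move=> /existsP [x /existsP [y /andP [xy /eqP ->]]].
  have [i [p [q [ik pq xE yE]]]] := ring_graphP x y xy.
  have -> : x = vertex (i * N + p) by apply: val_inj.
  have -> : y = vertex (i * N + q) by apply: val_inj.
  case/orP: pq => /frag_arcP [r rB [-> ->]];
    by exists (Ordinal ik, Ordinal rB) => //; rewrite // setUC.
move=> [[i r] _ ->]; apply/existsP; exists (vertex (i * N + arc_lo r)).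
apply/existsP; exists (vertex (i * N + arc_hi r)); rewrite eqxx andbT.
by apply: ring_edge; apply/orP; left; apply/frag_arcP; exists (val r) => //; apply: ltn_ord.
Qed.

Hypothesis g_large : 3 * k.-1 <= g.

Lemma ring_graph_edge_pancyclic : edge_pancyclic ring_graph.
Proof.
move=> x y; case/ring_graphP => j [p [q [_ pq xE yE]]] m; rewrite card_ord => mB.
have -> : x = vertex (j * N + p) by apply: val_inj.
have -> : y = vertex (j * N + q) by apply: val_inj.
have g0 : 1 < g by lia.
have [d [cyc dN thd thN]] := frag_good g0 pq.
have [md|md] := ltnP m (d + g); first by apply/ring_cycle_inside/cyc; lia.
have kN : k * N = k.-1 * N + N by rewrite -{1}(prednK (ltnW (ltnW k_gt2))) mulSn addnC.
(* When the edge is crossed in [N] steps, the two or more other fragments still receive at least [N]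
   steps, more than [3 * k.-1]. *)
have kN2 : 2 * N <= k.-1 * N by rewrite leq_mul2r; lia.
have [mN|mN] := leqP m (d + k.-1 * N).
  have -> : m = d + (m - d) by lia.
  by apply: ring_cycle_around => //; lia.
have -> : m = N + (m - N) by lia.
by apply: ring_cycle_around => //; rewrite /N in kN kN2 mN dN *; lia.
Qed.

End Ring.

Theorem theorem5 (k : nat) : 3 <= k ->
  let n := 6 * k ^ 2 - 5 * k in
  exists e : rel 'I_n,
    [/\ simple_graph e, edge_pancyclic e & #|edge_set e| = 2 * n - k].
Proof.
move=> k3; pose g := 3 * k.-1.
have nE : 6 * k ^ 2 - 5 * k = k * (2 * g).+1.
  by rewrite /g; case: (k) k3 => // k' _ /=; rewrite expnS expn1; nia.
rewrite /= nE.
exists (ring_graph (k := k) (g := g)); split.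
- by split; [apply: ring_graph_sym | apply: ring_graph_irr].
- exact: ring_graph_edge_pancyclic.
- by rewrite card_ring_edges // /g; nia.
Qed.
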